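(* Assume there exist $g$-sequential cardinals. Then the variety $\mathfrak V$ generated by free topological groups of metrizable spaces is a proper subclass of the class of all topological groups. For example, if $\mathrm{Card}(E)$ is a $g$-sequential cardinal, the topological group $\mathrm{Sym}(E)$ does not belong to $\mathfrak V$.
   Context: All topological groups are assumed Hausdorff. A class of topological groups is called a variety if it is closed under arbitrary products, subgroups, and topological quotient groups. The variety generated by a family of topological groups is the smallest variety containing that family. The (Markov) free topological group $F(X)$ on a Tikhonov (completely regular Hausdorff) space $X$ is the topological group characterized by the following property: $X$ is a subspace of $F(X)$, and every continuous mapping $f$ from $X$ to a topological group $G$ extends uniquely to a continuous homomorphism $\bar f:F(X)\to G$. For a set $E$ let $P(E)$ denote the set of all subsets of $E$. A subadditive measure on $E$ is a function $p:P(E)\to[0,1]$ such that: (1) $p(A\cup B)\le p(A)+p(B)$ for every $A,B\in P(E)$ with $A\cap B=\emptyset$; (2) for any decreasing sequence $A_1\supset A_2\supset\dots$ in $P(E)$ with $\bigcap_n A_n=\emptyset$ we have $\lim_n p(A_n)=0$. A cardinal $\tau=\mathrm{Card}(E)$ is $g$-sequential if there is a subadditive measure $p$ on $E$ such that $p(E)=1$ and $p(F)=0$ for all finite subsets $F\subset E$. For a set $E$, $\mathrm{Sym}(E)$ is the topological group of all permutations of $E$, equipped with the topology of pointwise convergence, $E$ being considered as a discrete space. *)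

(* Defs.v *)
From HB Require Import structures.
From mathcomp Require Import all_boot all_order all_algebra.
From mathcomp Require Import all_classical all_reals.
From mathcomp Require Import topology metric_structure.
Set Implicit Arguments.
Unset Strict Implicit.
Unset Printing Implicit Defensive.
Import Order.TTheory GRing.Theory Num.Theory.
Import numFieldTopology.Exports.
Local Open Scope classical_set_scope.
Local Open Scope group_scope.

HB.mixin Record isHausdorffTopGroup G of Group G & Topological G := {
  mulg_continuous : continuous (fun xy : G * G => xy.1 * xy.2) ;
  invg_continuous : continuous (fun x : G => x^-1) ;
  topgroup_hausdorff : hausdorff_space G
}.

#[short(type="topGroupType")]
HB.structure Definition TopGroup :=
  { G of Group G & Topological G & isHausdorffTopGroup G }.

Section ProdGroup.
Variables (I : Type) (G : I -> groupType).
Implicit Types f g h : prod_topology G.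

Definition prod_oneg : prod_topology G := fun=> 1.
Definition prod_invg f : prod_topology G := fun i => (f i)^-1.
Definition prod_mulg f g : prod_topology G := fun i => f i * g i.

Let mulA : associative prod_mulg.
Proof. by move=> f g h; apply: functional_extensionality_dep => i; exact: mulgA. Qed.
Let mul1 : left_id prod_oneg prod_mulg.
Proof. by move=> f; apply: functional_extensionality_dep => i; exact: mul1g. Qed.
Let mulr1 : right_id prod_oneg prod_mulg.
Proof. by move=> f; apply: functional_extensionality_dep => i; exact: mulg1. Qed.
Let mulV : left_inverse prod_oneg prod_invg prod_mulg.
Proof. by move=> f; apply: functional_extensionality_dep => i; exact: mulVg. Qed.
Let mulrV : right_inverse prod_oneg prod_invg prod_mulg.
Proof. by move=> f; apply: functional_extensionality_dep => i; exact: mulgV. Qed.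

HB.instance Definition _ :=
  isGroup.Build (prod_topology G) mulA mul1 mulr1 mulV mulrV.

End ProdGroup.

Section ProdTopGroup.
Variables (I : Type) (G : I -> topGroupType).

Lemma prod_topology_cvg (T : Type) (F : set_system T) {FF : Filter F}
    (K : I -> topologicalType) (f : T -> prod_topology K) (l : prod_topology K) :
  (forall i, (fun t => f t i) @ F --> l i) -> f @ F --> l.
Proof.
move=> fl; apply/cvg_sup => i A [B [[C oC <-] Cli CA]].
apply: (filterS CA); apply: (fl i); exact: open_nbhs_nbhs.
Qed.

Lemma prod_topology_proj (K : I -> topologicalType) i :
  continuous (fun f : prod_topology K => f i).
Proof. exact: (@proj_continuous {classic I} K i). Qed.

Let mul_cont :
  continuous (fun fg : prod_topology G * prod_topology G => fg.1 * fg.2).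
Proof.
move=> [f g]; apply: prod_topology_cvg => i.
have c : continuous (fun fg : prod_topology G * prod_topology G =>
    (fg.1 i, fg.2 i)).
  move=> x; apply: cvg_pair => /=.
    apply: (@continuous_comp _ _ _ fst (fun h : prod_topology G => h i)).
      exact: cvg_fst.
    exact: prod_topology_proj.
  apply: (@continuous_comp _ _ _ snd (fun h : prod_topology G => h i)).
    exact: cvg_snd.
  exact: prod_topology_proj.
exact: (continuous_comp (c (f, g)) (@mulg_continuous (G i) (f i, g i))).
Qed.

Let inv_cont : continuous (fun f : prod_topology G => f^-1).
Proof.
move=> f; apply: (@prod_topology_cvg _ _ (nbhs_filter f)) => i.
exact: (continuous_comp (@prod_topology_proj G i f)
  (@invg_continuous (G i) (f i))).
Qed.

Let prod_hausdorff : hausdorff_space (prod_topology G).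
Proof.
apply: (@hausdorff_product {classic I} G) => i; exact: topgroup_hausdorff.
Qed.

HB.instance Definition _ := isHausdorffTopGroup.Build (prod_topology G)
  mul_cont inv_cont prod_hausdorff.

End ProdTopGroup.

Definition Sym (E : Type) : Type := {f : E -> E | bijective f}.
Definition Sym_fun (E : Type) (s : Sym E) : E -> E := sval s.

HB.instance Definition _ (E : Type) := gen_eqMixin (Sym E).
HB.instance Definition _ (E : Type) := gen_choiceMixin (Sym E).

Section SymGroup.
Variable E : Type.
Implicit Types s t : Sym E.

Lemma Sym_inj : injective (@Sym_fun E).
Proof. by case=> f bf [g bg] /= fg; exact: eq_exist. Qed.

Definition Sym_one : Sym E := exist _ idfun (Bijective (frefl _) (frefl _)).
Definition Sym_mul s t : Sym E :=
  exist _ (Sym_fun s \o Sym_fun t) (bij_comp (svalP s) (svalP t)).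

Lemma Sym_inv_ex s : exists t, cancel (Sym_fun s) (Sym_fun t) /\
  cancel (Sym_fun t) (Sym_fun s).
Proof. by case: s => f [g fg gf]; exists (exist _ g (Bijective gf fg)). Qed.

Definition Sym_inv s : Sym E := sval (cid (Sym_inv_ex s)).

Lemma Sym_funK s : cancel (Sym_fun s) (Sym_fun (Sym_inv s)).
Proof. by rewrite /Sym_inv; case: cid => t []. Qed.
Lemma Sym_funVK s : cancel (Sym_fun (Sym_inv s)) (Sym_fun s).
Proof. by rewrite /Sym_inv; case: cid => t []. Qed.

Let mulA : associative Sym_mul.
Proof. by move=> s t u; exact: Sym_inj. Qed.
Let mul1 : left_id Sym_one Sym_mul.
Proof. by move=> s; exact: Sym_inj. Qed.
Let mulr1 : right_id Sym_one Sym_mul.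
Proof. by move=> s; exact: Sym_inj. Qed.
Let mulV : left_inverse Sym_one Sym_inv Sym_mul.
Proof. by move=> s; apply/Sym_inj/funext => x; exact: Sym_funK. Qed.
Let mulrV : right_inverse Sym_one Sym_inv Sym_mul.
Proof. by move=> s; apply/Sym_inj/funext => x; exact: Sym_funVK. Qed.

HB.instance Definition _ := isGroup.Build (Sym E) mulA mul1 mulr1 mulV mulrV.

Lemma Sym_mulE s t x : Sym_fun (s * t) x = Sym_fun s (Sym_fun t x).
Proof. by []. Qed.
Lemma Sym_invK s : cancel (Sym_fun s) (Sym_fun s^-1).
Proof. exact: Sym_funK. Qed.
Lemma Sym_invVK s : cancel (Sym_fun s^-1) (Sym_fun s).
Proof. exact: Sym_funVK. Qed.

End SymGroup.

Section SymTopGroup.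
Variable E : choiceType.

Definition Sym_ptws : Sym E -> {ptws E -> discrete_topology E} := @Sym_fun E.

HB.instance Definition _ :=
  Topological.copy (Sym E) (initial_topology Sym_ptws).

Lemma Sym_cvg (T : Type) (F : set_system T) {FF : Filter F}
    (f : T -> Sym E) (s : Sym E) :
  (forall x, \forall t \near F, Sym_fun (f t) x = Sym_fun s x) -> f @ F --> s.
Proof.
move=> fs A [B [[C oC <-] Cs CA]]; apply: (filterS CA).
have : Sym_ptws \o f @ F --> Sym_ptws s.
  apply: prod_topology_cvg => x D Dsx; apply: filterS (fs x) => t /= e.
  by rewrite /nbhs /= /Sym_ptws e; exact: nbhs_singleton Dsx.
by apply; exact: open_nbhs_nbhs.
Qed.

Lemma Sym_near (s : Sym E) x : \forall t \near s, Sym_fun t x = Sym_fun s x.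
Proof.
have c : continuous (fun t : Sym E => (Sym_ptws t : prod_topology _) x).
  move=> t; apply: (@continuous_comp _ _ _ Sym_ptws
    (fun f : {ptws E -> discrete_topology E} => f x)).
    exact: initial_continuous.
  exact: prod_topology_proj.
exact: (c s [set Sym_fun s x] (discrete_set1 _)).
Qed.

Let mul_cont : continuous (fun st : Sym E * Sym E => st.1 * st.2).
Proof.
move=> [s t]; apply: (@Sym_cvg _ _ (nbhs_filter (s, t))) => x.
have ft : \forall p \near (s, t), Sym_fun p.2 x = Sym_fun t x.
  exact: (@cvg_snd _ _ (nbhs s) (nbhs t) _ _ (Sym_near t x)).
have fs : \forall p \near (s, t),
    Sym_fun p.1 (Sym_fun t x) = Sym_fun s (Sym_fun t x).
  exact: (@cvg_fst _ _ (nbhs s) (nbhs t) _ _ (Sym_near s (Sym_fun t x))).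
apply: filterS2 ft fs => p e1 e2.
by rewrite -[LHS]/(Sym_fun p.1 (Sym_fun p.2 x)) e1 e2.
Qed.

Let inv_cont : continuous (fun s : Sym E => s^-1).
Proof.
move=> s; apply: (@Sym_cvg _ _ (nbhs_filter s)) => x.
apply: filterS (Sym_near s (Sym_fun s^-1 x)) => t.
by rewrite Sym_invVK => e; rewrite -{1}e Sym_invK.
Qed.

Let Sym_hausdorff : hausdorff_space (Sym E).
Proof.
move=> s t st; apply/Sym_inj/funext => x.
have [u [/= us ut]] := st _ _ (Sym_near s x) (Sym_near t x).
by rewrite -us.
Qed.

HB.instance Definition _ :=
  isHausdorffTopGroup.Build (Sym E) mul_cont inv_cont Sym_hausdorff.

End SymTopGroup.

(* Injective, and the topology of [X] is the one induced by [f]: [f] identifies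
   [X] with a subspace of [Y]. *)
Definition topological_embedding (X Y : topologicalType) (f : X -> Y) : Prop :=
  injective f /\ (@open X = [set f @^-1` B | B in @open Y]).

Definition group_hom (G H : groupType) (f : G -> H) : Prop :=
  {morph f : x y / x * y >-> x * y}.

(* Subgroups and quotient groups are taken up to topological isomorphism.  The
   group [Q] being Hausdorff, the kernel of a quotient map is closed. *)
Definition is_subgroup_of (H G : topGroupType) : Prop :=
  exists f : H -> G, group_hom f /\ topological_embedding f.

Definition is_quotient_of (Q G : topGroupType) : Prop :=
  exists f : G -> Q,
    [/\ group_hom f,
        set_surj [set: G] [set: Q] f &
        forall B : set Q, open B <-> open (f @^-1` B)].

(* [set topGroupType] would be universe-inconsistent: [topGroupType] lives above
   the universe of the carriers of [set]. *)
Definition topgroup_class := topGroupType -> Prop.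

Definition all_topgroups : topgroup_class := fun=> True.

Definition subclass (C D : topgroup_class) : Prop := forall G, C G -> D G.

Definition proper_subclass (C D : topgroup_class) : Prop :=
  subclass C D /\ ~ subclass D C.

Definition is_variety (V : topgroup_class) : Prop :=
  [/\ forall (I : Type) (G : I -> topGroupType),
        (forall i, V (G i)) -> V (prod_topology G),
      forall G H : topGroupType, V G -> is_subgroup_of H G -> V H &
      forall G Q : topGroupType, V G -> is_quotient_of Q G -> V Q].

Definition variety_generated (C : topgroup_class) : topgroup_class :=
  fun G => forall V : topgroup_class, is_variety V -> subclass C V -> V G.

Definition is_free_topgroup (X : topologicalType) (F : topGroupType)
    (i : X -> F) : Prop :=
  topological_embedding i /\
  forall (G : topGroupType) (f : X -> G), continuous f ->
    exists! fbar : F -> G,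
      [/\ group_hom fbar, continuous fbar & fbar \o i = f].

Definition metrizable (R : realType) (X : topologicalType) : Prop :=
  exists (M : metricType R) (h : X -> M),
    topological_embedding h /\ set_surj [set: X] [set: M] h.

Definition free_topgroup_of_metrizable (R : realType) : topgroup_class :=
  fun F => exists (X : topologicalType) (i : X -> F),
             metrizable R X /\ is_free_topgroup i.

Definition subadditive_measure (R : realType) (E : Type) (p : set E -> R) :
    Prop :=
  [/\ forall A, (0 <= p A <= 1)%R,
      forall A B, A `&` B = set0 -> (p (A `|` B) <= p A + p B)%R &
      forall A : nat -> set E, (forall n, A n.+1 `<=` A n) ->
        \bigcap_n A n = set0 -> (fun n => p (A n)) @ \oo --> (0 : R)%R].

(* A property of the cardinality of [E] only. *)
Definition g_sequential (R : realType) (E : Type) : Prop :=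
  exists p : set E -> R,
    [/\ subadditive_measure p, p [set: E] = 1%R &
        forall F : set E, finite_set F -> p F = 0%R].

(* Main.v *)
Require Import Defs.
From mathcomp Require Import all_boot all_order all_algebra.
From mathcomp Require Import all_classical all_reals.
From mathcomp Require Import topology metric_structure.
From HB Require Import structures.
From mathcomp Require Import lra.
(** Were the theorem false, [Sym E] would have every property that free groups
    of metrizable spaces have and that products, subgroups and quotients
    inherit.  The property [tame] separates them.  It speaks of sets of indices
    [e : E] that are small at level [k], for a scale [S] of families of subsets
    of [E] such that two sets small at level [k.+1] have a union small at level
    [k], vanishing sequences contain small sets, points are small and [E] is not
    (record [smallness]).  A group [G] is tame when, for every family
    [g : E -> G], every neighborhood [U] of 1 and every level [k], all [h]
    close enough to 1 satisfy [(g e)^-1 * h * g e \in U] for all [e] outside a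
    small set.

    Tameness is a variety ([tame_variety]).  For any group, the sets of such [h]
    define a finer group topology ([mostly_group_nbhs]).  A continuous map on a
    first countable space stays continuous for that topology
    ([continuous_retopologized]), because a countable base of neighborhoods of
    a point turns the sets of bad indices into a vanishing sequence.  By the
    universal property the topology of the free group is already that fine
    ([tame_free]).  On the other hand [Sym E] is not tame ([Sym_not_tame]): with
    transpositions for the [g e] and a point stabilizer for [U], the bad
    indices of [h] are the points that it moves, and there are permutations
    arbitrarily close to 1 that move almost all points.

    It remains to find a scale.  For a monotone measure [p] the sets of measure
    at most [2 ^ (- k) / 2] would do, but [p] is subadditive on disjoint sets
    only, and a subset of a null set can have a large measure.  Families closed
    under subsets have to be extracted from the vanishing property.  First, some
    set [A] of measure above 1/2 has no two disjoint subsets of measure above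
    1/2 ([unsplittable]); the sets disjoint from a large subset of [A] form a
    hereditary family on which, within [A], the measure is at most 1/2
    ([bounded_start]).  Next, shrinking [A] and raising the bound a little, this
    family can be joined with a further absorbing family ([bounded_step]).
    Repeating this gives infinitely many families no finite number of which
    cover [E] by taking one member each ([independent_families]), and a scale is
    obtained by repeatedly merging these families in pairs
    ([smallness_exists]). *)

Set Implicit Arguments.
Unset Strict Implicit.
Unset Printing Implicit Defensive.
Import Order.TTheory GRing.Theory Num.Theory.
Import numFieldTopology.Exports.
Local Open Scope classical_set_scope.

(** * Subadditive measures along monotone sequences *)

Section SubadditiveMeasure.
Variables (R : realType) (E : Type).
Implicit Types (A B X Y : set E) (C : nat -> set E) (V Q : set (set E)).
Local Open Scope ring_scope.

Definition vanishing C := (forall n, C n.+1 `<=` C n) /\ \bigcap_n C n = set0.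

Lemma decr_le C : (forall n, C n.+1 `<=` C n) ->
  forall m n, (m <= n)%N -> C n `<=` C m.
Proof.
move=> dC m n; elim: n => [|n IH]; first by rewrite leqn0 => /eqP ->.
rewrite leq_eqVlt => /predU1P[->//|]; rewrite ltnS => /IH mn.
exact: subset_trans (dC n) mn.
Qed.

Lemma vanishingP C : (forall n, C n.+1 `<=` C n) ->
  (forall x, exists n, ~ C n x) -> vanishing C.
Proof.
move=> dC nC; split=> //; rewrite -subset0 => x Cx.
by have [n] := nC x; apply; exact: Cx.
Qed.

Lemma vanishing_out C x : vanishing C -> exists n, ~ C n x.
Proof.
move=> [_ C0]; apply: contrapT => /forallNP h.
have : (\bigcap_n C n) x by move=> n _; exact: contrapT (h n).
by rewrite C0.
Qed.

Lemma vanishing_setI C A : vanishing C -> vanishing (fun n => A `&` C n).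
Proof.
move=> vC; apply: vanishingP => [n|x]; first by apply: setIS; case: vC.
by have [n nC] := vanishing_out x vC; exists n => -[].
Qed.

Variable p : set E -> R.
Hypothesis pm : subadditive_measure p.

Lemma subadd_ge0 A : 0 <= p A. Proof. by case: pm => /(_ A)/andP[]. Qed.

Lemma subadd_vanish C e : vanishing C -> 0 < e ->
  exists m, forall n, (m <= n)%N -> p (C n) < e.
Proof.
move=> [dC C0] e0; case: pm => _ _ /(_ C dC C0) cv.
have [m _ mP] := cv _ (nbhsx_ballx (0 : R) _ e0).
exists m => n mn; have := mP n mn.
by rewrite /ball /= sub0r normrN ger0_norm ?subadd_ge0.
Qed.

Lemma subadd_set0 : p set0 = 0.
Proof.
apply/eqP; rewrite eq_le subadd_ge0 andbT leNgt; apply/negP => p0.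
have vs : vanishing (fun=> set0 : set E).
  by apply: vanishingP => [n x //|x]; exists 0%N.
by have [m /(_ m (leqnn m))] := subadd_vanish vs p0; rewrite ltxx.
Qed.

Lemma subadd_split A X : p A <= p (A `\` X) + p (A `&` X).
Proof.
rewrite -{1}(setUIDK A X) setUC; case: pm => _ + _; apply.
by rewrite -subset0 => x [[_ nX] [_ /nX]].
Qed.

(** Lower bounds survive the removal of a far term of a vanishing sequence.
    This and the next lemma are what remains of the continuity of a measure
    when nothing is known about [p X] for the subsets [X] of a given set. *)
Lemma subadd_setD_vanishing A C c : vanishing C -> c < p A ->
  exists m, forall n, (m <= n)%N -> c < p (A `\` C n).
Proof.
move=> vC cA; have d0 : 0 < p A - c by lra.
have [m mP] := subadd_vanish (vanishing_setI A vC) d0.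
exists m => n /mP; have := subadd_split A (C n); lra.
Qed.

Lemma subadd_bigcap (X : nat -> set E) c : (forall n, X n.+1 `<=` X n) ->
  (forall n, c < p (X n)) -> c <= p (\bigcap_n X n).
Proof.
move=> dX cX; rewrite leNgt; apply/negP => Xc.
set I := \bigcap_n X n in Xc.
have vC : vanishing (fun n => X n `\` I).
  apply: vanishingP => [n x [/dX Xx nI]//|x].
  apply: contrapT => /forallNP h.
  have [_] := contrapT (h 0%N); apply=> n _.
  by have [] := contrapT (h n).
have d0 : 0 < c - p I by lra.
have [m /(_ m (leqnn m)) mP] := subadd_vanish vC d0.
have := subadd_split (X m) (X m `\` I); have := cX m.
have -> : X m `\` (X m `\` I) = I.
  rewrite setDD; apply/setIidPr => x; exact.
have -> : X m `&` (X m `\` I) = X m `\` I by apply/setIidPr => x [].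
lra.
Qed.

End SubadditiveMeasure.

(** * Absorbing families *)

Section Absorbing.
Variable E : Type.
Implicit Types (A B X Y : set E) (C : nat -> set E) (V W Q : set (set E)).

(** A hereditary family absorbs a set when its members can be enlarged by it.
    Think of the family of the sets of measure less than a constant, for a
    monotone measure: there is always room for a far term of a vanishing
    sequence and for a point. *)
Record absorbing V : Prop := Absorbing {
  absorbing0 : V set0;
  absorbing_sub : forall A B, A `<=` B -> V B -> V A;
  absorbing_vanish : forall A C, V A -> vanishing C -> exists n, V (A `|` C n);
  absorbing_point : forall A x, V A -> V (A `|` [set x]) }.

Definition sjoin V W : set (set E) :=
  [set X | exists A B, [/\ V A, W B & X `<=` A `|` B]].

Lemma absorbingT : absorbing setT.
Proof. by split=> // A C _ _; exists 0%N. Qed.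

Lemma absorbingI V W : absorbing V -> absorbing W -> absorbing (V `&` W).
Proof.
move=> aV aW; split.
- by split; exact: absorbing0.
- by move=> A B AB [VB WB]; split; [exact: absorbing_sub VB|exact: absorbing_sub WB].
- move=> A C [VA WA] vC.
  have [m Vm] := absorbing_vanish aV VA vC.
  have [n Wn] := absorbing_vanish aW WA vC.
  exists (maxn m n); have [dC _] := vC.
  by split; [apply: absorbing_sub Vm|apply: absorbing_sub Wn] => //;
    apply: setUS; apply: decr_le; rewrite // ?leq_maxl ?leq_maxr.
- by move=> A x [VA WA]; split; exact: absorbing_point.
Qed.

Lemma absorbing_shift V A : absorbing V -> V A ->
  absorbing [set B | V (A `|` B)].
Proof.
move=> aV VA; split => /=.
- by rewrite setU0.
- by move=> B X BX; apply: (absorbing_sub aV); exact: setUS.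
- move=> B C VB vC; have [n Vn] := absorbing_vanish aV VB vC.
  by exists n; rewrite setUA.
- by move=> B x VB; rewrite setUA; exact: absorbing_point.
Qed.

Lemma absorbing_join V W : absorbing V -> absorbing W -> absorbing (sjoin V W).
Proof.
move=> aV aW; split.
- by exists set0, set0; split; [exact: absorbing0|exact: absorbing0|].
- move=> A B AB [X [Y [VX WY BXY]]]; exists X, Y; split=> //.
  exact: subset_trans BXY.
- move=> A C [X [Y [VX WY AXY]]] vC.
  have [n Wn] := absorbing_vanish aW WY vC.
  by exists n, X, (Y `|` C n); split=> //; rewrite setUA; exact: setSU.
- move=> A x [X [Y [VX WY AXY]]]; exists X, (Y `|` [set x]).
  by split=> //; [exact: absorbing_point|rewrite setUA; exact: setSU].
Qed.

End Absorbing.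

(** * Sets that do not split *)

Section Tree.
Variables (R : realType) (E : Type) (p : set E -> R).
Hypothesis pm : subadditive_measure p.
Implicit Types (A B X Y : set E).
Local Open Scope ring_scope.

(** Disjoint splittings [L A], [N A] of all sets [A] make a binary tree of sets,
    and every point follows its own infinite branch, its address.  Finite
    branches are lists with the latest bit first. *)
Section Addresses.
Variable L : set E -> set E.
Variable N : set E -> set E.
Hypothesis LA : forall A, L A `<=` A.
Hypothesis NA : forall A, N A `<=` A.
Hypothesis LN : forall A, L A `&` N A = set0.

Fixpoint node (s : seq bool) : set E :=
  if s is b :: s' then (if b then L else N) (node s') else setT.

Fixpoint pre (x : nat -> bool) n : seq bool :=
  if n is n'.+1 then x n' :: pre x n' else [::].

Fixpoint address_set (e : E) n : set E :=
  if n is n'.+1 then (if `[< L (address_set e n') e >] then L else N) (address_set e n')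
  else setT.

(* Points outside both halves get the bit of [N]: their branch does not
   stay in the tree, and a cylinder can be larger than its node. *)
Definition address e n : bool := `[< L (address_set e n) e >].

Lemma address_setE e n : address_set e n = node (pre (address e) n).
Proof. by elim: n => //= n IH; rewrite -IH. Qed.

Lemma node_address e s : node s e -> pre (address e) (size s) = s.
Proof.
elim: s => //= b s IH h.
have es : node s e by case: b h => [/LA|/NA].
rewrite IH //; congr (_ :: _); rewrite /address address_setE IH //.
case: b h => h; first exact/asboolP.
by apply/asboolP => Le; have : (L (node s) `&` N (node s)) e by []; rewrite LN.
Qed.

(** A cylinder of addresses is not the corresponding node in general, because
    of the points lying in neither half; but it is when the last bit tells
    membership in [L]. *)
Lemma address_true s :
  [set e | pre (address e) (size s).+1 = true :: s] = node (true :: s).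
Proof.
apply/seteqP; split=> e; last by move=> /node_address.
move=> /= [ae es]; move: ae; rewrite /address address_setE es.
by move=> /asboolP.
Qed.

End Addresses.

Lemma prefix_limit (l : nat -> seq bool) (w : nat -> seq bool) :
  (forall k, l k.+1 = w k ++ l k) -> (forall k, (0 < size (w k))%N) ->
  exists x, forall k, pre x (size (l k)) = l k.
Proof.
move=> lS w0; pose x n := nth false (rev (l n.+1)) n.
have sz k : (k <= size (l k))%N.
  elim: k => // k IH; rewrite lS size_cat.
  by rewrite -addn1 addnC leq_add.
have mono k j : exists v, l (k + j)%N = v ++ l k.
  elim: j => [|j [v e]]; first by exists [::]; rewrite addn0.
  by exists (w (k + j)%N ++ v); rewrite addnS lS e catA.
have nthE k n : (n < size (l k))%N -> x n = nth false (rev (l k)) n.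
  move=> nk; rewrite /x; have [kn|/ltnW kn] := leqP n.+1 k.
    have [v] := mono n.+1 (k - n.+1)%N; rewrite subnKC // => ->.
    by rewrite rev_cat nth_cat size_rev sz.
  have [v] := mono k (n.+1 - k)%N; rewrite subnKC // => ->.
  by rewrite rev_cat nth_cat size_rev nk.
exists x => k.
have preE m : (m <= size (l k))%N -> pre x m = rev (take m (rev (l k))).
  elim: m => [|m IH] mk; first by rewrite take0.
  rewrite /= IH ?(ltnW mk) // (take_nth false) ?size_rev // rev_rcons.
  by rewrite (nthE k).
by rewrite preE // take_oversize ?size_rev // revK.
Qed.

Lemma size_pre x m : size (pre x m) = m.
Proof. by elim: m => //= m ->. Qed.

Lemma nth_pre x m n : (n < m)%N -> nth false (rev (pre x m)) n = x n.
Proof.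
elim: m => // m IH; rewrite ltnS leq_eqVlt rev_cons nth_rcons size_rev size_pre.
by case: ltngtP => // [nm _|->]; rewrite ?IH.
Qed.

Lemma pre_suffix x u v : pre x (size (u ++ v)) = u ++ v -> pre x (size v) = v.
Proof. by elim: u => //= a u IH [_ /IH]. Qed.

Definition cylinder (f : E -> nat -> bool) s := [set e | pre (f e) (size s) = s].

(** A Baire category argument on the space of addresses.  The ultrafilter [U]
    attaches to each address the bit it takes [U]-often; let [F] be the set of
    the points with limit bit [~~ b].  If all extensions of [t] could be
    extended further to a cylinder with a large trace on [F], one could
    interleave such extensions so as to build two addresses [x] and [y],
    bitwise complementary beyond [t], both having infinitely many prefixes with
    a large trace on [F].  One of them has limit bit [b], so that the traces of
    its prefixes on [F] decrease to the empty set: this contradicts the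
    vanishing property of [p]. *)
Lemma small_cylinder (f : E -> nat -> bool) (U : set (set nat)) (b : bool)
    (t : seq bool) c :
  UltraFilter U -> \oo `<=` U -> 0 < c ->
  exists w, forall s,
    p ([set e | U [set n | f e n = ~~ b]] `&` cylinder f (s ++ w ++ t)) <= c.
Proof.
move=> UU ooU c0; apply: contrapT => /forallNP bad.
set F := [set e | _] in bad.
have {bad} : forall w, exists s, c < p (F `&` cylinder f (s ++ w ++ t)).
  move=> w; have /existsNP[s /negP] := bad w; rewrite -ltNge => h.
  by exists s.
move=> /choice[g gP].
(* [d] is the common part beyond [t] of the branches under construction: a bad
   prefix of [x] ends at [s1 d ++ d], then [s2] is chosen to make the bitwise
   complement, which is read along [y], bad as well; the extra [true] makes
   every step advance. *)
pose s1 d := g (true :: d) ++ [:: true].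
pose s2 d := map negb (g (map negb (s1 d ++ d))).
pose step d := (s2 d ++ s1 d) ++ d.
pose d k := iter k step [::].
have [x xP] : exists x, forall k, pre x (size (d k ++ t)) = d k ++ t.
  apply: (@prefix_limit _ (fun k => s2 (d k) ++ s1 (d k))) => k.
    by rewrite catA.
  by rewrite !size_cat /= addnA addn1.
have [y yP] : exists y, forall k,
    pre y (size (map negb (d k) ++ t)) = map negb (d k) ++ t.
  apply: (@prefix_limit _ (fun k => map negb (s2 (d k) ++ s1 (d k)))) => k.
    by rewrite catA -map_cat.
  by rewrite size_map !size_cat /= addnA addn1.
have sd k : (k <= size (d k))%N.
  elim: k => // k IH; rewrite /d /= -/(d k) /step !size_cat /=.
  by rewrite addn1 addnS addSn ltnS (leq_trans IH) ?leq_addl.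
have xbad k : exists2 m, (k <= m)%N & c < p (F `&` cylinder f (pre x m)).
  exists (size (s1 (d k) ++ d k ++ t)).
    by rewrite !size_cat (leq_trans (sd k)) ?(addnCA _ (size (d k))) ?leq_addr.
  rewrite (@pre_suffix x (s2 (d k))); last by have := xP k.+1; rewrite /= -!catA.
  by rewrite /s1 -catA; exact: gP.
have ybad k : exists2 m, (k <= m)%N & c < p (F `&` cylinder f (pre y m)).
  exists (size (map negb (d k.+1) ++ t)).
    by rewrite size_cat size_map (leq_trans (ltnW (sd k.+1))) ?leq_addr.
  rewrite yP /= /step -catA map_cat -catA {1}/s2 -map_comp.
  by rewrite (@eq_map _ _ _ id negbK) map_id; exact: gP.
have yx n : (size t <= n)%N -> y n = ~~ x n.
  move=> tn; have nd : (n - size t < size (d n.+1))%N.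
    by apply: leq_trans (sd n.+1); rewrite ltnS leq_subr.
  have nx : (n < size (d n.+1 ++ t))%N by rewrite size_cat addnC -ltn_subLR.
  have ny : (n < size (map negb (d n.+1) ++ t))%N.
    by rewrite size_cat size_map addnC -ltn_subLR.
  rewrite -(nth_pre y ny) -(nth_pre x nx) xP yP.
  move: (d n.+1) nd => l nl; rewrite !rev_cat !nth_cat size_rev.
  by rewrite ltnNge tn /= -map_rev (nth_map false) ?size_rev.
(* an address with limit bit [b] cannot have infinitely many bad prefixes *)
suff [z Uz zbad] : exists2 z, U [set n | z n = b] &
    forall k, exists2 m, (k <= m)%N & c < p (F `&` cylinder f (pre z m)).
  pose C n := F `&` [set e | pre (f e) n = pre z n].
  have vC : vanishing C.
    apply: vanishingP => [n e [Fe] /= [_ en] //|e].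
    apply: contrapT => /forallNP h.
    have fz n : f e n = z n by have [_ []] := contrapT (h n.+1).
    have [Fe _] := contrapT (h 0%N).
    have [n /= [zb fb]] := filter_ex (filterI Uz Fe).
    by move: fb; rewrite fz zb; case: (b).
  have [m mP] := subadd_vanish pm vC c0.
  have [k mk] := zbad m; rewrite ltNge => /negP; apply.
  by rewrite /cylinder size_pre; exact: ltW (mP k mk).
have [Ux|Ux] := in_ultra_setVsetC [set n | x n = b] UU; first by exists x.
exists y => //; have Ut : U [set n | (size t <= n)%N].
  by apply: ooU; exists (size t).
apply: filterS (filterI Ux Ut) => n /= [xb tn]; rewrite yx //.
by move: xb; case: (x n); case: (b) => // /(_ erefl).
Qed.

(** Otherwise all sets of measure above [c] split, and give a tree with nodes
    of measure above [c].  Two applications of [small_cylinder], one for each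
    limit bit, give a cylinder meeting both classes of points in measure at
    most [c / 2], whereas this cylinder is a node. *)
Lemma unsplittable c : 0 < c -> c < p setT -> exists A, c < p A /\
  forall X Y, X `<=` A -> Y `<=` A -> X `&` Y = set0 -> c < p X -> p Y <= c.
Proof.
move=> c0 cT; apply: contrapT => nA.
have : forall A, exists XY : set E * set E,
    [/\ XY.1 `<=` A, XY.2 `<=` A, XY.1 `&` XY.2 = set0 &
        c < p A -> c < p XY.1 /\ c < p XY.2].
  move=> A; have [cA|cA] := pselect (c < p A); last first.
    by exists (set0, set0); split=> //=; rewrite setI0.
  apply: contrapT => h; apply: nA; exists A; split=> // X Y XA YA XY0 cX.
  rewrite leNgt; apply/negP => cY; apply: h; exists (X, Y); split=> //.
move=> /choice[g gP].
pose L A := (g A).1; pose N A := (g A).2.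
have LA A : L A `<=` A by have [] := gP A.
have NA A : N A `<=` A by have [] := gP A.
have LN A : L A `&` N A = set0 by have [] := gP A.
have cnode s : c < p (node L N s).
  by elim: s => //= b s /(let: And4 _ _ _ h := gP _ in h)[]; case: b.
have [U [UU ooU]] := ultraFilterLemma eventually_filter.
pose f := address L N; pose h := c / 2.
have h0 : 0 < h by rewrite divr_gt0.
have [w1 w1P] := small_cylinder f true [::] UU ooU h0.
have [w2 w2P] := small_cylinder f false (w1 ++ [::]) UU ooU h0.
(* the last bit is [true] in order that the cylinder be a node *)
pose s := true :: w2 ++ w1.
have ph b : p ([set e | U [set n | f e n = b]] `&` cylinder f s) <= h.
  case: b; first by have := w2P [:: true]; rewrite cats0.
  by have := w1P (true :: w2); rewrite cats0.
have : c < p (cylinder f s).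
  by rewrite /cylinder (address_true LA NA LN); exact: cnode.
have := subadd_split pm (cylinder f s) [set e | U [set n | f e n = true]].
have -> : cylinder f s `\` [set e | U [set n | f e n = true]] =
    [set e | U [set n | f e n = false]] `&` cylinder f s.
  rewrite setIC setDE; congr (_ `&` _); apply/seteqP; split=> e /= Ue.
    have [//|] := in_ultra_setVsetC [set n | f e n = true] UU.
    by apply: filterS => n /=; case: (f e n).
  move=> Ut; have [n /= [-> //]] := filter_ex (filterI Ut Ue).
rewrite (setIC (cylinder f s)).
have := ph true; have := ph false; rewrite /h; lra.
Qed.

End Tree.

(** * Independent absorbing families *)

Section Independent.
Variables (R : realType) (E : Type) (p : set E -> R).
Hypothesis pm : subadditive_measure p.
Hypothesis p_point : forall x, p [set x] = 0%R.
Implicit Types (A B X Y : set E) (V W Q : set (set E)).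
Local Open Scope ring_scope.

Definition bounded_on Q A c := forall X, Q X -> X `<=` A -> p X <= c.

(** Take for [A] a set that does not split and for [Q] the sets disjoint from
    some subset of [A] of measure above [c]; [Q] is absorbing because a measure
    above [c] stays so after the removal of a far term or of a point. *)
Lemma bounded_start c : 0 < c -> c < p setT ->
  exists Q A, [/\ absorbing Q, c < p A & bounded_on Q A c].
Proof.
move=> c0 cT; have [A [cA Asplit]] := unsplittable pm c0 cT.
exists [set Y | exists X, [/\ X `<=` A, X `&` Y = set0 & c < p X]], A.
split=> //; last first.
  by move=> Y [X [XA XY cX]] YA; exact: Asplit XA YA XY cX.
split.
- by exists A; split=> //; rewrite setI0.
- move=> Y Z YZ [X [XA XZ cX]]; exists X; split=> //.
  by rewrite -subset0 -XZ; exact: setIS.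
- move=> Y C [X [XA XY cX]] vC.
  have [m mP] := subadd_setD_vanishing pm vC cX.
  exists m, (X `\` C m); split; last exact: mP.
    by move=> x [/XA].
  rewrite -subset0 => x [[Xx nC] [Yx|//]].
  by rewrite -XY.
- move=> Y x [X [XA XY cX]]; exists (X `\` [set x]); split.
  + by move=> y [/XA].
  + rewrite -subset0 => y [[Xy nx] [Yy|//]].
    by rewrite -XY.
  + have := subadd_split pm X [set x].
    suff : p (X `&` [set x]) = 0 by lra.
    have [Xx|nXx] := pselect (X x).
      by rewrite (_ : _ `&` _ = [set x]) //; apply/setIidPr => y ->.
    rewrite (_ : _ `&` _ = set0) ?(subadd_set0 pm) // -subset0.
    by move=> y [Xy xy]; move: Xy; rewrite xy.
Qed.

(** If no [V] works, shrink [A] repeatedly: given [X] and an absorbing [W],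
    there are [q] in [Q] and [w] in [W] with [q `|` w] inside [X] and of measure
    above [c'].  This yields a decreasing sequence [X n.+1 = q n `|` w n], where
    each [W] is chosen so small that the sets
    [u m n = q m `|` w m.+1 `|` .. `|` w n.-1] are all in [Q].  The intersection
    [L] of the [X n] has measure at least [c'], hence above [c], and so has
    [L] deprived of the points whose last exit from the [q i] occurs at a
    suitable [m] or later.  Each of the remaining points lies in [u m n] for [n] large,
    so one [u m n] contains a subset of [A] of measure above [c]: this
    contradicts the bound on [Q]. *)
Lemma bounded_step Q A c c' :
    absorbing Q -> c < c' -> c' < p A -> bounded_on Q A c ->
  exists V A', [/\ absorbing V, A' `<=` A, c' < p A' &
                 bounded_on (sjoin Q V) A' c'].
Proof.
move=> aQ cc' c'A bQ; apply: contrapT => nV.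
(* the state: a set [X] of measure above [c'] and a family [W] *)
pose ok (s : set E * set (set E)) :=
  [/\ s.1 `<=` A, c' < p s.1 & absorbing s.2].
have : forall s, exists qw : set E * set E, ok s ->
    [/\ Q qw.1, s.2 qw.2, qw.1 `|` qw.2 `<=` s.1 & c' < p (qw.1 `|` qw.2)].
  move=> [X W]; have [[/= XA c'X aW]|] := pselect (ok (X, W)); last first.
    by exists (set0, set0).
  apply: contrapT => h; apply: nV; exists W, X; split=> // Y.
  move=> [q [w [Qq Ww Yqw]]] YX; rewrite leNgt; apply/negP => c'Y.
  apply: h; exists (Y `&` q, Y `&` w) => _ /=; rewrite -setIUr.
  have -> : Y `&` (q `|` w) = Y by apply/setIidPl.
  by split=> //; [exact: absorbing_sub Qq|exact: absorbing_sub Ww].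
move=> /choice[g gP].
pose step s := ((g s).1 `|` (g s).2,
  [set y | Q ((g s).1 `|` y)] `&` [set y | s.2 ((g s).2 `|` y)]).
pose s n := iter n step (A, setT).
have sok n : ok (s n).
  elim: n => [|n IH]; first by split=> //; exact: absorbingT.
  have [Qq Ww qwX c'qw] := gP _ IH; have [XA c'X aW] := IH.
  split=> //=; first exact: subset_trans XA.
  by apply: absorbingI; exact: absorbing_shift.
pose q n := (g (s n)).1; pose w n := (g (s n)).2; pose X n := (s n).1.
have XS n : X n.+1 = q n `|` w n by [].
have dX n : X n.+1 `<=` X n by have [] := gP _ (sok n).
have c'X n : c' < p (X n) by have [] := sok n.
pose u m n := q m `|` \bigcup_(i in [set i | (m < i < n)%N]) w i.
have uQ m n : Q (u m n).
  suff uQ' k y : (s (m + k).+1).2 y -> Q (u m (m + k).+1 `|` y).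
    have aW : absorbing (s (m + n).+1).2 by have [] := sok (m + n).+1.
    apply: absorbing_sub aQ _ _ _ (uQ' n set0 (absorbing0 aW)).
    rewrite setU0; apply: setUS => x [i /= /andP[mi ni] wx].
    exists i => //=; rewrite mi /=; apply: leq_trans ni _.
    by rewrite (leq_trans (leq_addl m n)).
  elim: k y => [|k IH] y.
    move=> [/= Qy _]; rewrite addn0 in Qy *.
    apply: absorbing_sub aQ _ _ _ Qy; apply: setSU => x [//|[i /=]].
    by rewrite ltnS ltnNge => /andP[/negP].
  rewrite addnS => -[/= _ /IH]; apply: absorbing_sub aQ _ _ _.
  rewrite setUA; apply: setSU => x [qx|[i /= /andP[mi]]]; first by left; left.
  rewrite ltnS leq_eqVlt => /predU1P[->|ik] wx; first by right.
  by left; right; exists i => //=; rewrite mi.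
pose L := \bigcap_n X n.
have cL : c < p L by apply: lt_le_trans cc' (subadd_bigcap pm dX c'X).
(* the points whose last exit from the [q i] occurs at [m] or later *)
pose D m := [set x | exists2 i, (m <= i)%N &
  ~ q i x /\ forall j, (i < j)%N -> q j x].
have vD : vanishing D.
  apply: vanishingP => [m x [i mi h]|x]; first by exists i => //; exact: ltnW.
  have [[i [nqi qj]]|h] := pselect (exists i, ~ q i x /\ forall j, (i < j)%N -> q j x).
    by exists i.+1 => -[j ij [nqj _]]; apply: nqj; exact: qj.
  by exists 0%N => -[i _ hi]; apply: h; exists i.
have [m mP] := subadd_setD_vanishing pm vD cL.
have {mP} cLD := mP m (leqnn m).
have vu : vanishing (fun n => (L `\` D m) `\` u m n).
  apply: vanishingP => [n x [LDx nux]|x].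
    split=> // -[qx|[i /= /andP[mi ni] wx]]; apply: nux; first by left.
    by right; exists i => //=; rewrite mi ltnS ltnW.
  apply: contrapT => /forallNP h; have [[Lx nDx] _] := contrapT (h 0%N).
  have nu n : ~ u m n x by have [] := contrapT (h n).
  apply: nDx; exists m => //; split=> [qx|j mj]; first by apply: (nu 0%N); left.
  have [//|wx] : X j.+1 x by exact: Lx.
  by have [] := nu j.+1; right; exists j => //=; rewrite mj /=.
have [n nP] := subadd_setD_vanishing pm vu cLD.
have {nP} := nP n (leqnn n); rewrite setDD ltNge => /negP; apply.
apply: bQ; last by move=> x [[/(_ 0%N I)]].
by apply: absorbing_sub (uQ m n) => //; exact: subIsetr.
Qed.

(** Iterating [bounded_step] gives families [V n], sets [A n] and increasing
    constants [c n] such that [p] is at most [c n] on the subsets of [A n]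
    covered by members of [V 0], .., [V n].  If these members covered
    everything, [p] would be at most [c n] on the intersection of the [A k],
    whose measure is at least [c n.+1]. *)
Lemma independent_families c : 0 < c -> c < p setT ->
  exists V : nat -> set (set E), (forall n, absorbing (V n)) /\
    forall n D, (forall i, (i < n)%N -> V i (D i)) ->
      ~ (setT `<=` \bigcup_(i in [set i | (i < n)%N]) D i).
Proof.
move=> c0 cT; have [Q0 [A0 [aQ0 cA0 bQ0]]] := bounded_start c0 cT.
(* the state: the join of the families chosen so far, a set and a bound *)
pose ok (s : set (set E) * (set E * R)) :=
  [/\ absorbing s.1, s.2.2 < p s.2.1 & bounded_on s.1 s.2.1 s.2.2].
have : forall s, exists Vs : set (set E) * (set (set E) * (set E * R)),
    ok s -> [/\ absorbing Vs.1, ok Vs.2, Vs.2.2.1 `<=` s.2.1,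
      s.2.2 < Vs.2.2.2 & Vs.2.1 = sjoin s.1 Vs.1].
  move=> [Q [A d]]; have [[/= aQ dA bQ]|] := pselect (ok (Q, (A, d))); last first.
    by exists (Q, (Q, (A, d))).
  pose d' := (d + p A) / 2.
  have dd' : d < d' by rewrite /d'; lra.
  have d'A : d' < p A by rewrite /d'; lra.
  have [V [A' [aV A'A d'A' bV]]] := bounded_step aQ dd' d'A bQ.
  exists (V, (sjoin Q V, (A', d'))) => _; split=> //; split=> //=.
  exact: absorbing_join.
move=> /choice[g gP].
pose s n := iter n (fun s => (g s).2) (Q0, (A0, c)).
have sok n : ok (s n) by elim: n => // n /gP[].
pose V n := if n is n'.+1 then (g (s n')).1 else Q0.
have aV n : absorbing (V n) by case: n => // n; have [] := gP _ (sok n).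
exists V; split=> // n D VD cov.
pose A n := (s n).2.1.
have dA k : A k.+1 `<=` A k by have [] := gP _ (sok k).
have cS k : (s k).2.2 < (s k.+1).2.2 by have [] := gP _ (sok k).
have cmono k j : (s k).2.2 <= (s (k + j)%N).2.2.
  by elim: j => [|j IH]; rewrite ?addn0 // addnS (le_trans IH) // ltW.
have inQ k : (forall i, (i < k.+1)%N -> V i (D i)) ->
    (s k).1 (\bigcup_(i in [set i | (i < k.+1)%N]) D i).
  elim: k => [|k IH] VDk.
    apply: absorbing_sub aQ0 _ _ _ (VDk 0%N isT) => x [i /=].
    by rewrite ltnS leqn0 => /eqP ->.
  have [_ _ _ _ Qk] := gP _ (sok k).
  rewrite [(s k.+1).1]Qk.
  exists (\bigcup_(i in [set i | (i < k.+1)%N]) D i), (D k.+1); split.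
  - by apply: IH => i ik; apply: VDk; rewrite ltnS ltnW.
  - exact: VDk.
  - move=> x [i /=]; rewrite ltnS leq_eqVlt => /predU1P[->|ik]; first by right.
    by left; exists i.
case: n VD cov => [|n] VD cov.
  have [x _] : exists x, A0 x.
    apply: contrapT => /forallNP h; have : A0 = set0 by rewrite -subset0.
    by move=> A00; move: cA0; rewrite A00 (subadd_set0 pm) ltNge (ltW c0).
  by have [] := cov x I.
have [aQ _ bQ] := sok n.
pose L := \bigcap_k A (n.+1 + k)%N.
have cL : (s n.+1).2.2 <= p L.
  apply: (subadd_bigcap pm) => k; first by rewrite addnS.
  by apply: le_lt_trans (cmono n.+1 k) _; have [] := sok (n.+1 + k)%N.
have : p L <= (s n).2.2.
  apply: bQ.
    by apply: absorbing_sub aQ _ _ _ (inQ n VD) => x _; exact: cov.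
  by apply: subset_trans (dA n) => x /(_ 0%N I); rewrite addn0.
by have := cS n; lra.
Qed.

End Independent.

(** * Scales of small sets *)

Section Scales.
Variable E : Type.
Implicit Types (A B X Y : set E) (C : nat -> set E).

(** What the families [S k] of the sets of measure at most [2 ^ (- k) / 2] are
    for a monotone subadditive measure of total mass 1 without atoms. *)
Record smallness (S : nat -> set (set E)) : Prop := Smallness {
  small_sub : forall k A B, A `<=` B -> S k B -> S k A;
  small_double : forall k A B, S k.+1 A -> S k.+1 B -> S k (A `|` B);
  small_vanish : forall k C, vanishing C -> exists n, S k (C n);
  small_point : forall k x, S k [set x];
  small_proper : forall k, ~ S k setT }.

Definition finite_join (V : nat -> set (set E)) : set (set E) :=
  [set B | exists n D, (forall i, (i < n)%N -> V i (D i)) /\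
    B `<=` \bigcup_(i in [set i | (i < n)%N]) D i].

(** A member of [halve V n] can play the role of a member of [V n.*2] and of one
    of [V n.*2.+1]; so two finite joins of halves fit into one finite join. *)
Definition halve (V : nat -> set (set E)) n : set (set E) := V n.*2 `&` V n.*2.+1.

Lemma absorbing_halve V : (forall n, absorbing (V n)) ->
  forall n, absorbing (halve V n).
Proof. by move=> aV n; exact: absorbingI. Qed.

Lemma finite_join_halve V A B : (forall n, absorbing (V n)) ->
  finite_join (halve V) A -> finite_join (halve V) B -> finite_join V (A `|` B).
Proof.
move=> aV [m [D [VD AD]]] [n [F [VF BF]]].
pose G (l : nat) (H : nat -> set E) i := if (i < l)%N then H i else set0.
exists (maxn m n).*2, (fun i => if odd i then G n F i./2 else G m D i./2).
split=> [i _|x [/AD[i /= im Dx]|/BF[i /= i_n Fx]]].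
- rewrite -{1}(odd_double_half i) /G; case: (odd i); rewrite ?add0n ?add1n.
    by case: ltnP => [/VF[]//|_]; exact: absorbing0.
  by case: ltnP => [/VD[]//|_]; exact: absorbing0.
- exists i.*2 => /=; first by rewrite ltn_double leq_max im.
  by rewrite odd_double doubleK /G im.
- exists i.*2.+1 => /=; last by rewrite odd_double uphalf_double /G i_n.
  by rewrite -doubleS leq_double leq_max i_n orbT.
Qed.

Lemma sub_finite_join V : V 0%N `<=` finite_join V.
Proof.
move=> A VA; exists 1%N, (fun=> A); split=> [[|]//|x Ax].
by exists 0%N.
Qed.

Lemma smallness_exists (R : realType) : g_sequential R E ->
  exists S, smallness S.
Proof.
move=> [p [pm p1 pfin]].
have c0 : (0 < 2^-1 :> R)%R by rewrite invr_gt0.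
have cT : (2^-1 < p setT)%R by rewrite p1; lra.
have pp x : p [set x] = 0%R by exact/pfin/finite_set1.
have [V [aV Vproper]] := independent_families pm pp c0 cT.
pose W k := iter k halve V.
have aW k : forall n, absorbing (W k n).
  by elim: k => // k IH; exact: absorbing_halve.
exists (fun k => finite_join (W k)).
have sub k A B : A `<=` B -> finite_join (W k) B -> finite_join (W k) A.
  by move=> AB [n [D [WD BD]]]; exists n, D; split=> //; exact: subset_trans BD.
have double k A B : finite_join (W k.+1) A -> finite_join (W k.+1) B ->
    finite_join (W k) (A `|` B).
  exact: finite_join_halve.
split=> //.
- move=> k C vC; have [n] := absorbing_vanish (aW k 0%N) (absorbing0 (aW k 0%N)) vC.
  by rewrite set0U => WC; exists n; exact: sub_finite_join.
- move=> k x; apply: (@sub_finite_join (W k)); rewrite -(set0U [set x]).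
  by apply: (absorbing_point (aW k 0%N)); exact: absorbing0.
- elim=> [[n [D [VD]]]|k IH /(fun h => double _ _ _ h h)]; first exact: Vproper VD.
  by rewrite setUid.
Qed.

End Scales.

(** * Group topologies given by the neighborhoods of 1 *)

Section TopGroupBasics.
Local Open Scope group_scope.

Lemma group_hom1 (G H : groupType) (f : G -> H) : group_hom f -> f 1 = 1.
Proof. by move=> fM; apply: (mulgI (f 1)); rewrite -fM !mulg1. Qed.

Lemma group_homV (G H : groupType) (f : G -> H) x : group_hom f -> f x^-1 = (f x)^-1.
Proof.
by move=> fM; apply: (mulgI (f x)); rewrite -fM !mulgV group_hom1.
Qed.

Lemma embedding_continuous (X Y : topologicalType) (f : X -> Y) :
  topological_embedding f -> continuous f.
Proof.
move=> [_ fo]; apply/continuousP => B oB.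
by rewrite [open]fo; exists B.
Qed.

Variable G : topGroupType.
Implicit Types (A U : set G) (x y : G).

Lemma cvg_mulg (T : Type) (F : set_system T) (FF : Filter F) (f g : T -> G) x y :
  f @ F --> x -> g @ F --> y -> (fun t => f t * g t) @ F --> x * y.
Proof.
move=> fx gy.
exact: (cvg_comp _ _ (cvg_pair fx gy) (@mulg_continuous G (x, y))).
Qed.

Lemma nbhs_translate x A : nbhs x A -> nbhs (1 : G) [set h | A (x * h)].
Proof.
have : (fun h => x * h) @ (1 : G) --> x * 1.
  by apply: cvg_mulg; [exact: cvg_cst|exact: cvg_id].
by rewrite mulg1; apply.
Qed.

Lemma nbhs_mul_sub U : nbhs (1 : G) U ->
  exists2 B, nbhs (1 : G) B & forall x y, B x -> B y -> U (x * y).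
Proof.
move=> U1; have := @mulg_continuous G (1, 1) U.
rewrite /= mulg1 => /(_ U1)[[B C] /= [B1 C1] BC].
exists (B `&` C); first exact: filterI.
by move=> x y [Bx _] [_ Cy]; exact: (BC (x, y)).
Qed.

Lemma nbhs_inv_sub U : nbhs (1 : G) U -> nbhs (1 : G) [set x | U x^-1].
Proof. by move=> U1; have := @invg_continuous G 1 U; rewrite invg1; apply. Qed.

End TopGroupBasics.

Section GroupTopology.
Local Open Scope group_scope.

(** A neighborhood filter of 1 for a group topology on [G] finer than the given
    one; being finer makes the new topology Hausdorff. *)
Record group_nbhs (G : topGroupType) (N : set_system G) : Prop := GroupNbhs {
  gnbhs_filter : Filter N;
  gnbhs_fine : nbhs (1 : G) `<=` N;
  gnbhs1 : forall A, N A -> A 1;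
  gnbhsM : forall A, N A -> exists2 B, N B & forall x y, B x -> B y -> A (x * y);
  gnbhsV : forall A, N A -> N [set x | A x^-1];
  gnbhsJ : forall A x, N A -> N [set h | A (x^-1 * h * x)] }.

(** [NG] is kept as a parameter so that the topology can be inferred from the
    type. *)
Definition retopologized (G : topGroupType) (N : set_system G)
  (NG : group_nbhs N) : Type := G.

Variables (G : topGroupType) (N : set_system G) (NG : group_nbhs N).
Local Notation H := (retopologized NG).

HB.instance Definition _ := Group.copy H G.

Definition retop_nbhs (x : H) : set_system H := [set A : set H | N [set h | A (x * h)]].
HB.instance Definition _ := hasNbhs.Build H retop_nbhs.

Let nbhs_pfilter (x : H) : ProperFilter (nbhs x).
Proof.
have NF := gnbhs_filter NG.
by apply: Build_ProperFilter_ex => A /(gnbhs1 NG) xA; exists (x * 1).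
Qed.

Let nbhs_single (x : H) (A : set H) : nbhs x A -> A x.
Proof. by move=> /(gnbhs1 NG) /=; rewrite mulg1. Qed.

Let nbhs_nbhs' (x : H) (A : set H) : nbhs x A -> nbhs x (nbhs^~ A).
Proof.
have NF := gnbhs_filter NG.
move=> /(gnbhsM NG)[B NB BA].
suff : N [set h : H | N [set k : H | A (x * h * k)]] by [].
apply: (@filterS _ N _ B) (NB) => // h Bh; apply: (@filterS _ N _ B) (NB) => k Bk.
by have := BA h k Bh Bk; rewrite /= mulgA.
Qed.

HB.instance Definition _ :=
  Nbhs_isNbhsTopological.Build H nbhs_pfilter nbhs_single nbhs_nbhs'.

Let mul_cont : continuous (fun xy : H * H => xy.1 * xy.2 : H).
Proof.
have NF := gnbhs_filter NG.
move=> [x y] A NA.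
have /(gnbhsM NG)[B NB BA] : N [set h : H | A (x * y * h)] := NA.
exists ([set z : H | B (y^-1 * (x^-1 * z) * y)], [set z : H | B (y^-1 * z)]).
  split.
    suff : N [set h : H | B (y^-1 * (x^-1 * (x * h)) * y)] by [].
    apply: (@filterS _ N _ [set h : G | B (y^-1 * h * y)]).
      by move=> h /= Bh; rewrite mulKg.
    exact: (gnbhsJ NG y NB).
  suff : N [set h : H | B (y^-1 * (y * h))] by [].
  by apply: (@filterS _ N _ B) (NB) => h /=; rewrite mulKg.
move=> [a b] /= [Ba Bb]; have := BA _ _ Ba Bb => /=.
by rewrite !mulgA mulgK mulgK mulgV mul1g.
Qed.

Let inv_cont : continuous (fun x : H => x^-1 : H).
Proof.
have NF := gnbhs_filter NG.
move=> x A NA; have {}NA : N [set h : H | A (x^-1 * h)] := NA.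
suff : N [set h : H | A (x * h)^-1] by [].
apply: (@filterS _ N _ [set h : H | A (x^-1 * (x^-1^-1 * h^-1 * x^-1))]).
  by move=> h /= Ah; rewrite invgM; move: Ah; rewrite invgK !mulgA mulVg mul1g.
exact: (gnbhsV NG (gnbhsJ NG x^-1 NA)).
Qed.

Let hausdorff : hausdorff_space H.
Proof.
move=> x y xy; apply: (@topgroup_hausdorff G) => A B xA yB; apply: xy.
  exact: (gnbhs_fine NG (nbhs_translate xA)).
exact: (gnbhs_fine NG (nbhs_translate yB)).
Qed.

HB.instance Definition _ := isHausdorffTopGroup.Build H mul_cont inv_cont hausdorff.

End GroupTopology.

(** * Tame topological groups *)

Section Tame.
Variables (E : Type) (S : nat -> set (set E)).
Hypothesis sS : smallness S.
Local Open Scope group_scope.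

Lemma small0 k : S k set0.
Proof.
have [|n] := small_vanish sS k (C := fun=> set0); last by [].
by apply: vanishingP => [n x //|x]; exists 0%N.
Qed.

Lemma small_le j k : (j <= k)%N -> S k `<=` S j.
Proof.
move=> /subnKC <-; elim: (k - j)%N => [|n IH]; first by rewrite addn0.
rewrite addnS => A SA; apply: IH; rewrite -(setU0 A).
by apply: small_double SA _ => //; exact: small0.
Qed.

Definition mostly (G : topGroupType) (g : E -> G) (U : set G) k : set G :=
  [set h | S k [set e | ~ U ((g e)^-1 * h * g e)]].

(** For a constant family [g] this is the continuity of a conjugation.  For an
    arbitrary family, the sets [mostly g U k] contain the identity but have no
    reason to be neighborhoods of it. *)
Definition tame (G : topGroupType) : Prop :=
  forall (g : E -> G) U k, nbhs (1 : G) U -> nbhs (1 : G) (mostly g U k).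

Lemma mostlyS (G : topGroupType) (g : E -> G) (U V : set G) k :
  U `<=` V -> mostly g U k `<=` mostly g V k.
Proof. by move=> UV h; apply: (small_sub sS) => e nV /UV. Qed.

Lemma mostlyI (G : topGroupType) (g : E -> G) (U V : set G) k :
  mostly g U k.+1 `&` mostly g V k.+1 `<=` mostly g (U `&` V) k.
Proof.
move=> h [hU hV]; apply: (small_sub sS) (small_double sS hU hV) => e /= nUV.
by apply: contrapT => /not_orP[/contrapT ? /contrapT ?]; apply: nUV.
Qed.

Lemma mostly_filter (G : topGroupType) :
  Filter [set U : set G | forall g k, nbhs (1 : G) (mostly g U k)].
Proof.
split.
- move=> g k; apply: filterS filterT => h _.
  by apply: (small_sub sS) (small0 k) => e /= /(_ I).
- move=> U V hU hV g k.
  by apply: filterS (filterI (hU g k.+1) (hV g k.+1)); exact: mostlyI.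
- by move=> U V UV hU g k; apply: filterS (hU g k); exact: mostlyS.
Qed.

(** The sets whose [mostly] sets are neighborhoods of 1 form a filter, so only
    the cylinders over one factor matter. *)
Lemma tame_prod (I : Type) (G : I -> topGroupType) :
  (forall i, tame (G i)) -> tame (prod_topology G).
Proof.
move=> tG g U k U1.
pose F : set_system (prod_topology G) :=
  [set V | forall g k, nbhs (1 : prod_topology G) (mostly g V k)].
have FF : Filter F := mostly_filter (prod_topology G).
suff F1 : nbhs (1 : prod_topology G) `<=` F by exact: (F1 U U1 g k).
apply: (@prod_topology_cvg I _ F FF G id 1) => i A A1 h j.
exact: (@prod_topology_proj I G i 1 _ (tG i (fun e => h e i) A j A1)).
Qed.

Lemma tame_subgroup (G H : topGroupType) : tame G -> is_subgroup_of H G -> tame H.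
Proof.
move=> tG [f [fM femb]] g U k U1.
have [O [oO O1] OU] : exists2 O, open_nbhs (1 : H) O & O `<=` U by rewrite nbhsE in U1.
have [_ fo] := femb.
have [B oB BO] : [set f @^-1` B | B in @open G] O by rewrite -fo.
have B1 : nbhs (1 : G) B.
  apply: open_nbhs_nbhs; split=> //.
  by rewrite -(group_hom1 fM); rewrite -BO in O1.
have fc : continuous f by exact: embedding_continuous.
have := fc 1 (mostly (f \o g) B k); rewrite (group_hom1 fM) => /(_ (tG _ _ _ B1)) W.
apply: (@filterS _ (nbhs (1 : H)) _ (f @^-1` mostly (f \o g) B k)) W => h /=.
apply: (small_sub sS) => e /= nU Bh.
by apply: nU; apply: OU; rewrite -BO /= !fM group_homV.
Qed.

Lemma tame_quotient (G Q : topGroupType) : tame G -> is_quotient_of Q G -> tame Q.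
Proof.
move=> tG [f [fM fsurj fo]] g U k U1.
have fc : continuous f by apply/continuousP => B /fo.
have fV y : exists x, f x = y by have [x _ <-] := fsurj y I; exists x.
have /choice[g' g'E] : forall e, exists x, f x = g e by move=> e; exact: fV.
have fU1 : nbhs (1 : G) (f @^-1` U).
  by have := fc 1 U; rewrite (group_hom1 fM); apply.
have := tG g' _ k fU1; rewrite nbhsE => -[O [oO O1] OW].
rewrite nbhsE; exists (f @` O).
  split; last by exists 1 => //; exact: group_hom1.
  apply/fo.
  rewrite openE => x [y Oy fxy].
  (* the saturation of [O] is a union of translates of [O] *)
  have : nbhs y O by exact: open_nbhs_nbhs.
  move=> /nbhs_translate yO.
  have : (fun z => x^-1 * z) @ x --> (x^-1 * x : G).
    by apply: cvg_mulg; [exact: cvg_cst|exact: cvg_id].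
  rewrite mulVg => /(_ _ yO) W.
  apply: (@filterS _ (nbhs x) _ [set z | O (y * (x^-1 * z))]) W => z /= Oz.
  exists (y * (x^-1 * z)) => //.
  by rewrite !fM (group_homV _ fM) fxy mulVKg.
move=> _ [h Oh <-]; have := OW h Oh; apply: (small_sub sS) => e /=.
by rewrite !fM (group_homV _ fM) g'E.
Qed.

Lemma tame_variety : is_variety tame.
Proof.
split; [exact: tame_prod|exact: tame_subgroup|exact: tame_quotient].
Qed.

Section TameTopology.
Variable G : topGroupType.

(** The finite intersections of the sets [mostly g U k] are the neighborhoods of
    1 for a group topology.  A single family [g] would not give a topology
    stable under conjugation: conjugating replaces [g] by a translate. *)
Definition mostly_nbhs : set_system G :=
  [set A | exists n (g : nat -> E -> G) U k,
     nbhs (1 : G) U /\ \bigcap_(i in [set i | (i < n)%N]) mostly (g i) U k `<=` A].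

Lemma mostly_group_nbhs : group_nbhs mostly_nbhs.
Proof.
split.
- split.
  + by exists 0%N, (fun _ _ => 1), setT, 0%N; split=> //; exact: filterT.
  + move=> A B [m [g [U [k [U1 UA]]]]] [n [h [V [l [V1 VB]]]]].
    exists (m + n)%N, (fun i => if (i < m)%N then g i else h (i - m)%N).
    exists (U `&` V), (maxn k l); split=> [|x xUV]; first exact: filterI.
    split.
      apply: UA => i /= im; have := xUV i; rewrite /= ltn_addr // im => /(_ isT).
      by move=> /(mostlyS (@subIsetl _ U V)); apply: small_le; exact: leq_maxl.
    apply: VB => i /= im; have := xUV (m + i)%N.
    rewrite /= ltn_add2l im => /(_ isT); rewrite ltnNge leq_addr /= addKn.
    by move=> /(mostlyS (@subIsetr _ U V)); apply: small_le; exact: leq_maxr.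
  + move=> A B AB [m [g [U [k [U1 UA]]]]]; exists m, g, U, k; split=> //.
    exact: subset_trans AB.
- move=> U U1; exists 1%N, (fun _ _ => 1), U, 0%N; split=> // x /(_ 0%N isT).
  rewrite /mostly /= => Sx; apply: contrapT => nU; apply: (small_proper sS).
  by apply: (small_sub sS) Sx => e _ /=; rewrite invg1 mul1g mulg1.
- move=> A [m [g [U [k [U1 UA]]]]]; apply: UA => i _.
  apply: (small_sub sS) (small0 k) => e /=; rewrite mulg1 mulVg.
  by apply; exact: nbhs_singleton.
- move=> A [m [g [U [k [U1 UA]]]]].
  have [V V1 VU] := nbhs_mul_sub U1.
  exists (\bigcap_(i in [set i | (i < m)%N]) mostly (g i) V k.+1).
    by exists m, g, V, k.+1; split=> // x.
  move=> x y xV yV; apply: UA => i im.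
  apply: (small_sub sS) (small_double sS (xV i im) (yV i im)) => e /= nU.
  apply: contrapT => /not_orP[/contrapT Vx /contrapT Vy]; apply: nU.
  by have := VU _ _ Vx Vy; rewrite !mulgA mulgK.
- move=> A [m [g [U [k [U1 UA]]]]].
  exists m, g, [set x | U x^-1], k; split; first exact: nbhs_inv_sub.
  move=> x xV; apply: UA => i im.
  apply: (small_sub sS) (xV i im) => e /=.
  by rewrite !invgM invgK mulgA.
- move=> A x [m [g [U [k [U1 UA]]]]].
  exists m, (fun i e => x * g i e), U, k; split=> // h hU; apply: UA => i im.
  apply: (small_sub sS) (hU i im) => e /=.
  by rewrite !invgM !mulgA.
Qed.

End TameTopology.

End Tame.

(** * Free groups of first countable spaces *)

Section FirstCountable.

Definition nbhs_base (X : topologicalType) (x : X) (B : nat -> set X) : Prop :=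
  [/\ forall n, nbhs x (B n), forall n, B n.+1 `<=` B n &
      forall A, nbhs x A -> exists n, B n `<=` A].

Lemma metrizable_nbhs_base (R : realType) (X : topologicalType) (x : X) :
  metrizable R X -> exists B, nbhs_base x B.
Proof.
move=> [M [h [hemb _]]].
exists (fun n => [set y | ball (h x) (n.+1%:R^-1 : R)%R (h y)]); split.
- move=> n; have hc : continuous h by exact: embedding_continuous.
  by apply: (hc x); apply: nbhsx_ballx; rewrite invr_gt0 ltr0n.
- move=> n y /=; apply: le_ball; rewrite lef_pV2 ?posrE ?ltr0n //.
  by rewrite ler_nat.
- move=> A; rewrite nbhsE => -[O [oO Ox] OA].
  have [_ ho] := hemb.
  have [B oB BO] : [set h @^-1` B | B in @open M] O by rewrite -ho.
  have : nbhs (h x) B.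
    by apply: open_nbhs_nbhs; split=> //; rewrite -BO in Ox.
  move=> /nbhs_ballP[d /= d0 dB].
  have [n] := ltr_add_invr d0; rewrite add0r => nd.
  exists n => y /= xy; apply: OA; rewrite -BO; apply: dB.
  by apply: le_ball xy; exact: ltW.
Qed.

End FirstCountable.

Section FreeGroup.
Variables (E : Type) (S : nat -> set (set E)).
Hypothesis sS : smallness S.
Local Open Scope group_scope.

(** First countability enters here: the indices [e] for which some point of
    [B n] is sent to a bad element form a sequence of sets that vanishes, since
    each [e] is good on some [B n]; so one of these sets is small. *)
Lemma continuous_mostly (X : topologicalType) (x : X) (B : nat -> set X)
    (G : topGroupType) (f : X -> G) (g : E -> G) U k :
  nbhs_base x B -> continuous f -> nbhs (1 : G) U ->
  nbhs x [set y | mostly S g U k ((f x)^-1 * f y)].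
Proof.
move=> [Bx dB Bb] fc U1.
pose C n := [set e | exists2 y, B n y & ~ U ((g e)^-1 * ((f x)^-1 * f y) * g e)].
have vC : vanishing C.
  apply: vanishingP => [n e [y /dB By nU]|e]; first by exists y.
  have : (fun y => (g e)^-1 * ((f x)^-1 * f y) * g e) @ x -->
      (g e)^-1 * ((f x)^-1 * f x) * g e.
    apply: cvg_mulg; last exact: cvg_cst.
    apply: cvg_mulg; first exact: cvg_cst.
    by apply: cvg_mulg; [exact: cvg_cst|exact: fc].
  rewrite mulVg mulg1 mulVg => /(_ _ U1)/Bb[n BU].
  by exists n => -[y /BU].
have [n Sn] := small_vanish sS k vC.
apply: (@filterS _ (nbhs x) _ (B n)) (Bx n) => y By.
by apply: (small_sub sS) Sn => e nU; exists y.
Qed.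

Lemma continuous_retopologized (X : topologicalType) (G : topGroupType) (f : X -> G) :
  (forall x : X, exists B, nbhs_base x B) -> continuous f ->
  continuous (f : X -> retopologized (mostly_group_nbhs sS G)).
Proof.
move=> Xb fc x A [n [g [U [k [U1 UA]]]]].
have [B xB] := Xb x.
suff : nbhs x [set y | forall i, (i < n)%N -> mostly S (g i) U k ((f x)^-1 * f y)].
  apply: filterS => y fy; have := UA ((f x)^-1 * f y) fy.
  by rewrite /= mulVKg.
elim: n {UA} => [|n IH]; first exact: filterS filterT.
apply: filterS (filterI IH (continuous_mostly (g n) k xB fc U1)) => y [IHy ny] i.
by rewrite ltnS leq_eqVlt => /predU1P[->//|/IHy].
Qed.

(** The map [i] stays continuous for the finer topology of [mostly_nbhs], so it
    extends to a continuous homomorphism from [F] to the retopologized [F].  By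
    uniqueness this extension is the identity, and the finer topology is that
    of [F]. *)
Lemma tame_free (X : topologicalType) (F : topGroupType) (i : X -> F) :
  (forall x : X, exists B, nbhs_base x B) -> is_free_topgroup i -> tame S F.
Proof.
move=> Xb [iemb univ] g U k U1.
have ic : continuous i by exact: embedding_continuous.
pose H : topGroupType := retopologized (mostly_group_nbhs sS F).
have [fbar [[fM fc fi] _]] := univ H i (continuous_retopologized Xb ic).
have [h [_ h_uniq]] := univ F i ic.
have fid : fbar = id.
  have <- : h = id by apply: h_uniq; split=> // y A.
  symmetry; apply: (h_uniq fbar); split=> //.
  move=> x A xA; apply: (fc x).
  exact: (gnbhs_fine (mostly_group_nbhs sS F) (nbhs_translate xA)).
have := fc 1 (mostly S g U k); rewrite fid; apply.
exists 1%N, (fun=> g), U, k; split=> // x /(_ 0%N isT) gx.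
by have := gx; rewrite -[in X in X -> _](mul1g x).
Qed.

End FreeGroup.

(** * The symmetric group is not tame *)

Section SymNotTame.
Variable E : choiceType.
Implicit Types (F D : set E).
Local Open Scope group_scope.

(** The right-hand sides define a filter, which converges pointwise to 1. *)
Lemma Sym_nbhs1 (A : set (Sym E)) : nbhs (1 : Sym E) A ->
  exists2 F, finite_set F & forall h : Sym E, (forall x, F x -> Sym_fun h x = x) -> A h.
Proof.
pose N : set_system (Sym E) := [set A | exists2 F, finite_set F &
  forall h : Sym E, (forall x, F x -> Sym_fun h x = x) -> A h].
have NF : Filter N.
  split.
  - by exists set0.
  - move=> U V [F fF FU] [F' fF' FV]; exists (F `|` F').
      by rewrite finite_setU.
    move=> h hF; split; [apply: FU|apply: FV] => x Fx; apply: hF; by [left|right].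
  - by move=> U V UV [F fF FU]; exists F => // h /FU /UV.
apply: (@Sym_cvg E _ N NF id 1) => x; exists [set x] => // h; exact.
Qed.

Definition transpose (a b x : E) : E := if x == a then b else if x == b then a else x.

Lemma transposeK a b : involutive (transpose a b).
Proof.
move=> x; rewrite /transpose; have [->|xa] := eqVneq x a.
  by rewrite eqxx; case: eqP.
have [->|xb] := eqVneq x b; first by rewrite eqxx.
by rewrite (negPf xa) (negPf xb).
Qed.

Definition involution_Sym (f : E -> E) (fK : involutive f) : Sym E :=
  exist _ f (Bijective fK fK).

(** The graph of a partial involution of the complement of [F] without fixed
    points. *)
Definition matching F (P : set (E * E)) : Prop :=
  [/\ forall x y, P (x, y) -> P (y, x), forall x y z, P (x, y) -> P (x, z) -> y = z &
      forall x y, P (x, y) -> [/\ ~ F x & x != y]].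

(** In a maximal matching two unmatched points outside [F] could be matched
    with each other. *)
Lemma matching_max F : exists2 P, matching F P &
  forall a b, ~ F a -> ~ F b -> (forall z, ~ P (a, z)) -> (forall z, ~ P (b, z)) -> a = b.
Proof.
have [C Cm Ctot|P [Pm Pmax]] := @Zorn_bigcup _ (matching F).
  split.
  - by move=> x y [Q CQ Qxy]; exists Q => //; have [+ _ _] := Cm Q CQ; exact.
  - move=> x y z [Q CQ Qxy] [Q' CQ' Qxz].
    have [QQ'|QQ'] := Ctot _ _ CQ CQ'.
      by have [_ + _] := Cm Q' CQ'; apply=> //; [exact: QQ' Qxy|].
    by have [_ + _] := Cm Q CQ; apply=> //; [exact: Qxy|exact: QQ'].
  - by move=> x y [Q CQ Qxy]; have [_ _] := Cm Q CQ; exact.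
exists P => // a b Fa Fb Pa Pb; apply: contrapT => ab.
have [sP fP nP] := Pm.
have Pa' z : ~ P (z, a) by move=> /sP; exact: Pa.
have Pb' z : ~ P (z, b) by move=> /sP; exact: Pb.
apply: (Pmax (P `|` [set (a, b)] `|` [set (b, a)])).
  split; last by move=> h; apply: (Pa b); apply: h; left; right.
  by move=> z Pz; left; left.
split.
- move=> x y [[Pxy|[-> ->]]|[-> ->]]; last by left; right.
    by left; left; exact: sP.
  by right.
- move=> x y z.
  move=> [[Pxy|[xa yb]]|[xb ya]] [[Pxz|[xa2 zb]]|[xb2 za]]; subst => //;
    try by [case: (Pa _ Pxy)|case: (Pb _ Pxy)|case: (Pa _ Pxz)|case: (Pb _ Pxz)].
  exact: fP Pxy Pxz.
- move=> x y [[Pxy|[-> ->]]|[-> ->]]; first exact: nP.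
    by split=> //; apply/eqP.
  by split=> //; apply/eqP => /esym.
Qed.

Lemma almost_free_involution F : exists s : Sym E,
  (forall x, F x -> Sym_fun s x = x) /\
  (forall a b, ~ F a -> ~ F b -> Sym_fun s a = a -> Sym_fun s b = b -> a = b).
Proof.
have [P [sP fP nP] Pmax] := matching_max F.
have /choice[f fE] : forall x, exists y, P (x, y) \/ y = x /\ forall z, ~ P (x, z).
  move=> x; have [[y Pxy]|/forallNP nPx] := pselect (exists y, P (x, y)).
    by exists y; left.
  by exists x; right.
have fK : involutive f.
  move=> x; have [Pxf|[-> nPx]] := fE x; last by have [/nPx|[->]] := fE x.
  by have [/fP|[_ /(_ x)]] := fE (f x); [apply; exact: sP|case; exact: sP].
exists (involution_Sym fK); split=> /= [x Fx|a b Fa Fb fa fb].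
  by rewrite /Sym_fun /=; have [/nP[]|[]] := fE x.
apply: Pmax => // z; rewrite /Sym_fun /= in fa fb.
  by have [|[_ +]] := fE a; [rewrite fa => /nP[_ /eqP]|exact].
by have [|[_ +]] := fE b; [rewrite fb => /nP[_ /eqP]|exact].
Qed.

Variable S : nat -> set (set E).
Hypothesis sS : smallness S.

Lemma small_finite k F : finite_set F -> S k F.
Proof.
move=> /finite_seqP[s ->]; elim: s k => [|x s IH] k.
  by apply: (small_sub sS) (small0 sS k).
apply: (small_sub sS) (small_double sS (small_point sS _ x) (IH k.+1)) => y /=.
by rewrite inE => /predU1P[->|ys]; [left|right].
Qed.

(** Let [U] be the stabilizer of [x0] and let [g e] exchange [x0] and [e]: then
    [s] moves [e] exactly when its conjugate by [g e] is not in [U].  Tameness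
    thus provides a finite set [F] such that the points moved by a permutation
    fixing [F] form a small set.  An involution fixing [F] and moving all other
    points but at most one then makes the whole of [E] small. *)
Lemma Sym_not_tame : ~ tame S (Sym E).
Proof.
move=> tE.
have [x0 _] : [set: E] !=set0.
  apply/set0P/eqP => E0; apply: (small_proper sS (k := 0%N)).
  by rewrite E0; exact: small0.
pose g e := involution_Sym (transposeK x0 e).
have [F fF FP] := Sym_nbhs1 (tE g _ 2%N (Sym_near 1 x0)).
have [s [sF s1]] := almost_free_involution F.
have Ss := FP s sF.
have SF := small_finite 2 fF.
have S1 : S 1%N [set x | ~ F x /\ Sym_fun s x = x].
  have [[a [Fa sa]]|/forallNP n] := pselect (exists a, ~ F a /\ Sym_fun s a = a).
    apply: (small_sub sS) (small_point sS 1 a) => b [Fb sb]; exact: s1.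
  by apply: (small_sub sS) (small0 sS 1) => b /n.
apply: (small_proper sS (k := 0%N)).
apply: (small_sub sS) (small_double sS (small_double sS Ss SF) S1) => e _.
have [Fe|nFe] := pselect (F e); first by left; right.
have [se|nse] := pselect (Sym_fun s e = e); first by right.
have ge : Sym_fun (g e) x0 = e by rewrite /Sym_fun /= /transpose eqxx.
suff nU : Sym_fun ((g e)^-1 * s * g e) x0 <> Sym_fun 1 x0 by left; left.
rewrite !Sym_mulE ge => /(congr1 (Sym_fun (g e))).
by rewrite Sym_invVK [X in _ = X]ge.
Qed.

End SymNotTame.

Lemma Sym_not_generated (R : realType) (E : choiceType) : g_sequential R E ->
  ~ variety_generated (free_topgroup_of_metrizable R) (Sym E).
Proof.
move=> /smallness_exists[S sS] /(_ _ (tame_variety sS)) gen.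
apply: (Sym_not_tame sS); apply: gen => F [X [i [mX Fi]]].
exact: (tame_free sS (fun x => metrizable_nbhs_base x mX) Fi).
Qed.

Theorem theorem2p13 (R : realType) :
  ((exists E : choiceType, g_sequential R E) ->
     proper_subclass (variety_generated (free_topgroup_of_metrizable R))
       all_topgroups) /\
  (forall E : choiceType, g_sequential R E ->
     ~ variety_generated (free_topgroup_of_metrizable R) (Sym E)).
Proof.
split=> [[E gE]|E]; last exact: Sym_not_generated.
by split=> // all; apply: (Sym_not_generated gE); exact: all.
Qed.
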